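(* Let $n\ge1$ and let $\Sigma$ be a finite set of $n\times n$ stochastic matrices. Every left-infinite product of matrices from $\Sigma$ converges to a rank one matrix if and only if every periodic left-infinite product of matrices from $\Sigma$ with period at most $p^*=\binom{n}{\lfloor n/3\rfloor}\left(2^{\,n-\lfloor n/3\rfloor-1}-1\right)$ converges to a rank one matrix.
   Context: A matrix is stochastic if it is nonnegative and each row sums to one. For a sequence $\sigma$ of indices into $\Sigma=\{A_1,\dots,A_m\}$, the left-infinite product $\dots A_{\sigma(2)}A_{\sigma(1)}$ converges to a matrix $M$ if $A_{\sigma(t)}\cdots A_{\sigma(1)}\to M$ as $t\to\infty$. The product is periodic with period $p$ if $\sigma(i+p)=\sigma(i)$ for all $i$. *)

(* Defs.v *)
From HB Require Import structures.
From mathcomp Require Import all_boot all_order all_algebra.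
From mathcomp Require Import all_classical all_reals all_analysis.
Set Implicit Arguments. Unset Strict Implicit. Unset Printing Implicit Defensive.
Import Order.TTheory GRing.Theory Num.Theory.
Import numFieldNormedType.Exports.
Local Open Scope classical_set_scope.
Local Open Scope ring_scope.

Definition stochastic (R : realType) (n : nat) (A : 'M[R]_n) : Prop :=
  (forall i j, 0 <= A i j) /\ (forall i, \sum_(j < n) A i j = 1).

(* prodL A sigma t = A (sigma (t-1)) *m ... *m A (sigma 0)
   (indices shifted: the paper's sigma(1), sigma(2), ... are sigma 0, sigma 1, ...). *)
Fixpoint prodL (R : realType) (n m : nat) (A : 'I_m -> 'M[R]_n)
    (sigma : nat -> 'I_m) (t : nat) : 'M[R]_n :=
  match t with
  | 0%N => 1%:M
  | t'.+1 => A (sigma t') *m prodL A sigma t'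
  end.

Definition lprod_converges_to (R : realType) (n m : nat) (A : 'I_m -> 'M[R]_n)
    (sigma : nat -> 'I_m) (M : 'M[R]_n) : Prop :=
  forall i j, (fun t => prodL A sigma t i j) @ \oo --> M i j.

Definition lprod_converges_rank1 (R : realType) (n m : nat) (A : 'I_m -> 'M[R]_n)
    (sigma : nat -> 'I_m) : Prop :=
  exists M : 'M[R]_n, lprod_converges_to A sigma M /\ \rank M = 1%N.

Definition periodic_with (m : nat) (sigma : nat -> 'I_m) (p : nat) : Prop :=
  (0 < p)%N /\ forall i, sigma (i + p)%N = sigma i.

Definition pstar (n : nat) : nat :=
  ('C(n, n %/ 3) * (2 ^ (n - n %/ 3 - 1) - 1))%N.

(* Main.v *)
(* For a stochastic matrix B let F_B(S) be the set of rows of B supported in S.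
   If S and S' are disjoint and t |-> F_{A_t} o ... o F_{A_1} keeps both of them
   nonempty, the product separates S from S', so consensus fails when this goes
   on periodically.  Conversely, if no pair survives N steps, any two rows of any
   product of length N have overlapping supports, and such products contract the
   gaps between rows by a uniform factor.

   If some pair survives long enough, the pigeonhole principle gives a recurrence
   P <= F(P); one of minimal length runs through an antichain of unordered pairs
   of disjoint nonempty sets.  Pairs {S, S'} with |S u S'| = k have 2(n-k) upper
   covers and between k-1 and k lower covers, so double counting allows to push
   an antichain up below level 2n/3 and down above it.  Level n - n/3 has exactly
   pstar n elements. *)
Require Import Defs.
From mathcomp Require Import all_boot zify.
Set Implicit Arguments. Unset Strict Implicit. Unset Printing Implicit Defensive.

(** * Antichains of pairs of disjoint sets *)

Lemma double_counting (U V : finType) (X : {set U}) (Y : {set V})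
    (r : U -> V -> bool) (d e : nat) :
  (forall x, x \in X -> d <= #|[set y in Y | r x y]|) ->
  (forall y, y \in Y -> #|[set x in X | r x y]| <= e) ->
  #|X| * d <= #|Y| * e.
Proof.
move=> hX hY; rewrite -!sum_nat_const.
apply: (@leq_trans (\sum_(x in X) #|[set y in Y | r x y]|)); first exact: leq_sum.
apply: (@leq_trans (\sum_(y in Y) #|[set x in X | r x y]|)); last exact: leq_sum.
have cardE (W : finType) (Z : {set W}) (p : pred W) :
  #|[set z in Z | p z]| = \sum_(z in Z) p z.
  rewrite -sum1_card big_mkcond [RHS]big_mkcond; apply: eq_bigr => z _.
  by rewrite inE; case: (z \in Z); case: (p z).
under eq_bigr do rewrite cardE.
by rewrite exchange_big /=; apply: leq_sum => y _; rewrite cardE.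
Qed.

Definition antichain (T : finType) (le : rel T) (X : {set T}) : Prop :=
  {in X &, forall x y, le x y -> x = y}.

(** The top level is replaced by its shadow until all ranks are at most [m]. The clause
    [y \in X \/ m <= rk y] says that nothing is pushed below level [m], so that an earlier push from
    the other side is not undone. *)
Lemma antichain_push_down (T : finType) (le : rel T) (rk : T -> nat)
    (D : {set T}) (m : nat) :
  transitive le ->
  {in D &, forall x y, le x y -> rk y <= rk x -> x = y} ->
  (forall k (X : {set T}), m <= k -> X \subset D ->
     (forall x, x \in X -> rk x = k.+1) ->
     #|X| <= #|[set y in D | (rk y == k) && [exists x in X, le y x]]|) ->
  forall X : {set T}, X \subset D -> antichain le X ->
  exists Y : {set T}, [/\ Y \subset D, antichain le Y, #|X| <= #|Y| &
    forall y, y \in Y -> rk y <= m /\ (y \in X \/ m <= rk y)].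
Proof.
move=> le_tr le_rk shadow X.
have [d] : exists d, forall x, x \in X -> rk x <= m + d.
  exists (\max_(x in X) rk x) => x xX.
  by apply: leq_trans (leq_addl _ _); apply: leq_bigmax_cond.
elim: d X => [|d IHd] X Xd XD Xanti.
  exists X; split=> // y yX; split; last by left.
  by have := Xd _ yX; rewrite addn0.
pose X1 := [set x in X | rk x == (m + d).+1].
pose S := [set y in D | (rk y == m + d) && [exists x in X1, le y x]].
have X1X : X1 \subset X by apply/subsetP => x; rewrite inE => /andP[].
have X1S : #|X1| <= #|S|.
  apply: shadow; first exact: leq_addr.
    exact: subset_trans XD.
  by move=> x; rewrite inE => /andP[_ /eqP].
have rk_low x : x \in X :\: X1 -> rk x <= m + d.
  rewrite !inE => /andP[+ xX]; rewrite xX /= => x1.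
  by have := Xd _ xX; rewrite addnS leq_eqVlt (negbTE x1).
have Sle y : y \in S -> rk y = m + d /\ exists2 x, x \in X1 & le y x.
  by rewrite inE => /and3P[_ /eqP-> /existsP[x /andP[xX1 yx]]]; split=> //; exists x.
have SD y : y \in S -> y \in D by rewrite inE => /andP[].
(* A point of [X] below the shadow would lie below some [z] of the removed level, against the
   antichain property. *)
have nS x y : x \in X :\: X1 -> y \in S -> ~ le x y.
  rewrite inE => /andP[xX1 xX] /Sle[_ [z zX1 yz]] xy.
  have xz : x = z by apply: Xanti (le_tr _ _ _ xy yz) => //; apply: (subsetP X1X).
  by rewrite xz zX1 in xX1.
(* Conversely, [rk x <= rk y] turns [le y x] into [y = x], so a point left in [X] would lie below
   the removed level. *)
have le_refl_S x y : x \in X :\: X1 -> y \in S -> le y x -> False.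
  move=> xX yS yx; have [yd [z zX1 yz]] := Sle _ yS.
  have yx' : y = x.
    apply: le_rk yx _; rewrite ?yd ?rk_low //; first exact: SD.
    by move: xX; rewrite inE => /andP[_ /(subsetP XD)].
  move: xX; rewrite inE -yx' => /andP[yX1 yX].
  have yz' : y = z by apply: Xanti yz => //; apply: (subsetP X1X).
  by rewrite yz' zX1 in yX1.
pose Y := (X :\: X1) :|: S.
have disj : [disjoint X :\: X1 & S].
  apply/pred0P => x /=; apply/negP => /andP[xX xS].
  have [_ [z zX1 xz]] := Sle _ xS.
  move: xX; rewrite inE => /andP[xX1 xX].
  have xz' : x = z by apply: Xanti xz => //; apply: (subsetP X1X).
  by rewrite xz' zX1 in xX1.
have [] := IHd Y.
- by move=> y; rewrite inE => /orP[/rk_low//|/Sle[-> _]].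
- rewrite subUset (subset_trans (subsetDl _ _) XD) /=.
  by apply/subsetP => y; rewrite inE => /andP[].
- move=> x y; rewrite !(in_setU) => /orP[xX|xS] /orP[yX|yS] xy.
  + by apply: Xanti => //; [move: xX | move: yX]; rewrite inE => /andP[].
  + by case: (nS _ _ xX yS).
  + by case: (le_refl_S _ _ yX xS).
  + by apply: le_rk xy _; rewrite ?SD //;
      have [-> _] := Sle _ xS; have [-> _] := Sle _ yS.
move=> Z [ZD Zanti YZ Zrk]; exists Z; split=> //.
  apply: leq_trans YZ; rewrite /Y cardsU.
  have -> : (X :\: X1) :&: S = set0 by apply/eqP; rewrite setI_eq0.
  rewrite cards0 subn0 cardsD (setIidPr X1X).
  by have := subset_leq_card X1X; lia.
move=> z zZ; have [zm zor] := Zrk _ zZ; split=> //.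
case: zor => [|?]; last by right.
rewrite inE => /orP[|/Sle[-> _]]; last by right; exact: leq_addr.
by rewrite inE => /andP[_ ?]; left.
Qed.

Lemma setD1_notin (T : finType) (x : T) (A : {set T}) : x \notin A -> A :\ x = A.
Proof. by move=> xA; apply/setDidPl; rewrite disjoint_sym disjoints1. Qed.

Lemma disjointsU1 (T : finType) (x : T) (A B : {set T}) :
  [disjoint x |: A & B] = (x \notin B) && [disjoint A & B].
Proof. by rewrite -!setI_eq0 setIUl setU_eq0 !setI_eq0 disjoints1. Qed.

(** * The poset of opposed pairs: covers, levels and shadows *)

Section OpposedPairs.
Variable T : finType.
Implicit Types (S : {set T}) (P Q : {set T} * {set T}).

Definition opposed P : bool :=
  [&& P.1 != set0, P.2 != set0 & [disjoint P.1 & P.2]].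

Definition pair_le P Q : bool := (P.1 \subset Q.1) && (P.2 \subset Q.2).

Definition swap P : {set T} * {set T} := (P.2, P.1).

Definition pair_rank P : nat := #|P.1| + #|P.2|.

Definition opposed_pairs : {set {set T} * {set T}} := [set P | opposed P].

Lemma pair_le_refl P : pair_le P P.
Proof. by rewrite /pair_le !subxx. Qed.

Lemma pair_le_trans : transitive pair_le.
Proof.
move=> Q P S /andP[a b] /andP[c d].
by rewrite /pair_le (subset_trans a c) (subset_trans b d).
Qed.

Lemma pair_le_rank P Q : pair_le P Q -> pair_rank Q <= pair_rank P -> P = Q.
Proof.
case: P Q => [a b] [c d] /andP[/= ac bd]; rewrite /pair_rank /= => h.
have hac := subset_leq_card ac; have hbd := subset_leq_card bd.
by congr pair; apply/eqP; rewrite eqEcard ?ac ?bd /=; move: h hac hbd; clear; lia.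
Qed.

Lemma pair_rankE P : [disjoint P.1 & P.2] -> pair_rank P = #|P.1 :|: P.2|.
Proof.
by move=> dP; rewrite /pair_rank cardsU (eqP (_ : P.1 :&: P.2 == set0))
  ?setI_eq0 // cards0 subn0.
Qed.

Lemma opposed_rank P : opposed P -> pair_rank P <= #|T|.
Proof. by move=> /and3P[_ _ dP]; rewrite pair_rankE // max_card. Qed.

Lemma opposed_rank_gt1 P : opposed P -> 1 < pair_rank P.
Proof. by move=> /and3P[]; rewrite -!card_gt0 /pair_rank; lia. Qed.

Definition upper_covers P : {set {set T} * {set T}} :=
  [set Q in opposed_pairs | pair_le P Q && (pair_rank Q == (pair_rank P).+1)].

Definition lower_covers Q : {set {set T} * {set T}} :=
  [set P in opposed_pairs | pair_le P Q && (pair_rank Q == (pair_rank P).+1)].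

(** An upper cover adds one point outside the union to one of the two sides; [g] parametrizes these
    choices. *)
Lemma card_upper_covers P :
  opposed P -> #|upper_covers P| = 2 * (#|T| - pair_rank P).
Proof.
case: P => a b sP; have /and3P[/= a0 b0 dab] := sP.
pose U := a :|: b; rewrite pair_rankE //= -/U.
have aU x : x \notin U -> (x \notin a) * (x \notin b).
  by rewrite inE negb_or => /andP[-> ->].
pose g (p : T * bool) := if p.2 then (p.1 |: a, b) else (a, p.1 |: b).
have -> : upper_covers (a, b) = g @: setX (~: U) setT.
  apply/setP => -[c d]; rewrite !inE /opposed /pair_le /=.
  apply/idP/imsetP => [/andP[/and3P[c0 d0 dcd] /andP[/andP[ac bd] rk]]|].
    move: rk; rewrite /pair_rank /= => rk.
    have hac := subset_leq_card ac; have hbd := subset_leq_card bd.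
    case: (ltnP #|a| #|c|) => h.
      have /eqP db : b == d by rewrite eqEcard bd; move: h hac rk; clear; lia.
      have /subsetPn[x xc xa] : ~~ (c \subset a).
        by apply: contraL h => /subset_leq_card; rewrite -leqNgt.
      exists (x, true); last rewrite /g /= -db.
        by rewrite !inE /= andbT (negbTE xa) /= db (disjointFr dcd xc).
      congr pair; apply/esym/eqP; rewrite eqEcard subUset sub1set xc ac /=.
      rewrite cardsU1 xa; move: hbd rk; clear; lia.
    have /eqP db : a == c by rewrite eqEcard ac.
    have /subsetPn[x xd xb] : ~~ (d \subset b).
      apply/negP => /subset_leq_card; rewrite db in rk; move: rk; clear; lia.
    exists (x, false); last rewrite /g /= -db.
      by rewrite !inE /= andbT (negbTE xb) orbF db (disjointFl dcd xd).
    congr pair; apply/esym/eqP; rewrite eqEcard subUset sub1set xd bd /=.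
    rewrite cardsU1 xb; move: hac rk; clear; lia.
  move=> [[x s]]; rewrite in_setX in_setT andbT in_setC /= => /aU[xa xb].
  rewrite /g /=; case: s => -[-> ->];
    rewrite /pair_rank /= ?a0 ?b0 ?subxx ?subsetU1 -?card_gt0 !cardsU1.
    by rewrite xa disjointsU1 xb dab addSn eqxx.
  by rewrite xb disjoint_sym disjointsU1 disjoint_sym xa dab addnS eqxx.
rewrite card_in_imset.
  by rewrite cardsX cardsT card_bool cardsCs setCK mulnC.
move=> [x s] [y t]; rewrite !in_setX !in_setT !andbT !in_setC /= => /aU[xa xb] /aU[ya yb].
have U1_inj (e : {set T}) : x \notin e -> x |: e = y |: e -> x = y.
  by move=> xe /setP/(_ x); rewrite !inE eqxx (negbTE xe) !orbF => e1; apply/eqP.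
have U1_ne (e : {set T}) z : z \notin e -> z |: e = e -> False.
  by move=> ze /setP/(_ z); rewrite !inE eqxx (negbTE ze).
rewrite /g /=; case: s; case: t => -[] h.
- by rewrite (U1_inj _ xa h).
- by case: (U1_ne _ _ xa h).
- by case: (U1_ne _ _ ya (esym h)).
- by rewrite (U1_inj _ xb h).
Qed.

(** A drop of one in rank removes a single point. It lies on one side only, so deleting it from both
    components leaves the other unchanged. *)
Lemma lower_coversE Q P : opposed Q -> P \in lower_covers Q ->
  exists2 x, x \in Q.1 :|: Q.2 & P = (Q.1 :\ x, Q.2 :\ x).
Proof.
case: P Q => [c d] [a b] /and3P[/= a0 b0 dab].
rewrite !inE /pair_le /pair_rank /= => /andP[_ /andP[/andP[ca db] /eqP rk]].
have hca := subset_leq_card ca; have hdb := subset_leq_card db.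
case: (ltnP #|c| #|a|) => h.
  have /eqP bd : d == b by rewrite eqEcard db; move: h hca rk; clear; lia.
  have /subsetPn[x xa xc] : ~~ (a \subset c).
    by apply: contraL h => /subset_leq_card; rewrite -leqNgt.
  exists x; first by rewrite inE xa.
  congr pair; apply/eqP; rewrite ?bd.
    rewrite eqEcard subsetD1 ca xc /=; move: (cardsD1 x a) hdb rk; rewrite xa; clear; lia.
  by rewrite eq_sym; apply/eqP/setD1_notin; rewrite (disjointFr dab xa).
have /eqP ac : c == a by rewrite eqEcard ca.
have /subsetPn[x xb xd] : ~~ (b \subset d).
  apply/negP => /subset_leq_card; rewrite ac in rk; move: rk; clear; lia.
exists x; first by rewrite inE xb orbT.
congr pair; apply/eqP; rewrite ?ac.
  by rewrite eq_sym; apply/eqP/setD1_notin; rewrite (disjointFl dab xb).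
rewrite eqEcard subsetD1 db xd /=; move: (cardsD1 x b) hca rk; rewrite xb; clear; lia.
Qed.

Lemma card_lower_covers_le Q :
  opposed Q -> #|lower_covers Q| <= pair_rank Q.
Proof.
move=> sQ; have /and3P[_ _ dQ] := sQ; rewrite pair_rankE //.
apply: leq_trans (leq_imset_card (fun x => (Q.1 :\ x, Q.2 :\ x)) _).
apply: subset_leq_card; apply/subsetP => P /(lower_coversE sQ)[x xQ ->].
exact: imset_f.
Qed.

(* At most one deletion empties a side of a pair of rank at least 3. *)
Lemma card_lower_covers_ge Q :
  opposed Q -> 2 < pair_rank Q -> (pair_rank Q).-1 <= #|lower_covers Q|.
Proof.
case: Q => a b sQ rk; have /and3P[/= a0 b0 dab] := sQ.
pose bad := [set x | (a == [set x]) || (b == [set x])].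
have bad1 : #|bad| <= 1.
  apply/card_le1_eqP => x y; rewrite !inE.
  move: rk; rewrite /pair_rank /= => rk.
  case/orP => /eqP ex; case/orP => /eqP ey.
  - by move: ex; rewrite ey => /set1_inj.
  - by move: rk; rewrite ex ey !cards1.
  - by move: rk; rewrite ex ey !cards1.
  - by move: ex; rewrite ey => /set1_inj.
pose f x := (a :\ x, b :\ x).
have f_inj : {in (a :|: b) :\: bad &, injective f}.
  move=> x y; rewrite inE => /andP[_ xab] _ [/setP/(_ x) + /setP/(_ x)].
  rewrite !in_setD1 eqxx /=; case: eqVneq => //= _ /esym xa /esym xb.
  by rewrite inE xa xb in xab.
apply: (@leq_trans #|f @: ((a :|: b) :\: bad)|).
  rewrite card_in_imset // pair_rankE //= cardsD.
  by have := subset_leq_card (subsetIr (a :|: b) bad); lia.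
apply: subset_leq_card; apply/subsetP => _ /imsetP[x + ->].
rewrite !inE negb_or => /andP[/andP[xa xb] xab].
rewrite /opposed /pair_le /= !subsetDl -!card_gt0.
have D1_gt0 (c : {set T}) : c != set0 -> c != [set x] -> 0 < #|c :\ x|.
  move=> c0 cx; rewrite card_gt0; apply: contra cx.
  by rewrite setD_eq0 subset1 (negbTE c0) orbF.
rewrite !D1_gt0 //= (disjointW (subsetDl _ _) (subsetDl _ _) dab) /=.
rewrite /pair_rank /= (cardsD1 x a) (cardsD1 x b).
case/orP: xab => h; rewrite h.
  by rewrite (disjointFr dab h) !add1n addSn.
by rewrite (disjointFl dab h) !add1n addnS.
Qed.

(** A pair is determined by its union and its first component, which is neither empty nor the whole
    union. *)
Lemma card_opposed_level k :
  #|[set P in opposed_pairs | pair_rank P == k]| <= 'C(#|T|, k) * (2 ^ k - 2).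
Proof.
pose h P := (P.1 :|: P.2, P.1).
pose X := [set P in opposed_pairs | pair_rank P == k].
have h_inj : {in X &, injective h}.
  move=> [a b] [c d]; rewrite !inE /h /= => /andP[/and3P[/= _ _ dab] _].
  move=> /andP[/and3P[/= _ _ dcd] _] [+ ac]; rewrite -{}ac in dcd *.
  move=> /(congr1 (fun S => S :\: a)); rewrite !setDUl setDv !set0U.
  by rewrite (setDidPl _) 1?disjoint_sym // (setDidPl _) 1?disjoint_sym // => ->.
rewrite -/X -(card_in_imset h_inj).
pose Y := [set p : {set T} * {set T} | (#|p.1| == k) &&
            (p.2 \in powerset p.1 :\: [set set0; p.1])].
apply: (@leq_trans #|Y|).
  apply: subset_leq_card; apply/subsetP => _ /imsetP[[a b] + ->].
  rewrite !inE /h /= => /andP[/and3P[/= a0 b0 dab] /eqP <-].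
  rewrite pair_rankE //= eqxx (negbTE a0) subsetUl andbT /=.
  apply: contra b0 => /eqP e; have <- : b :\: a = b by apply/setDidPl; rewrite disjoint_sym.
  by rewrite setD_eq0 e subsetUr.
rewrite -sum1_card (eq_bigl (fun p : {set T} * {set T} => (#|p.1| == k) &&
            (p.2 \in powerset p.1 :\: [set set0; p.1]))); last by move=> p; rewrite inE.
rewrite -(pair_big_dep (fun U : {set T} => #|U| == k)
  (fun U S => S \in powerset U :\: [set set0; U]) (fun _ _ => 1)) /=.
rewrite -card_draws -sum_nat_const big_mkcond [X in _ <= X]big_mkcond /=.
apply: leq_sum => U _; rewrite inE; case: eqP => // <-.
rewrite sum1_card cardsD card_powerset.
have /setIidPr -> : [set set0; U] \subset powerset U.
  by apply/subsetP => S; rewrite !inE => /orP[]/eqP->; rewrite ?sub0set.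
(* For [U] empty the two excluded subsets coincide, but 2^0 - 1 and the truncated 2^0 - 2 are both
   0. *)
rewrite cards2; have [<-|_] := eqVneq set0 U; last by [].
by rewrite cards0.
Qed.

(** Each pair of rank r has 2(|T| - r) >= r + 1 upper covers, and a pair of rank r + 1 has at most r
    + 1 lower covers. *)
Lemma card_upper_shadow r (X : {set {set T} * {set T}}) :
  3 * r < 2 * #|T| -> X \subset opposed_pairs ->
  (forall P, P \in X -> pair_rank P = r) ->
  #|X| <= #|[set Q in opposed_pairs |
              (pair_rank Q == r.+1) && [exists P in X, pair_le P Q]]|.
Proof.
move=> hr /subsetP XD Xr; set Y := (Y in _ <= #|Y|).
have r_le : r.+1 <= 2 * (#|T| - r) by move: hr; clear; lia.
rewrite -(leq_pmul2r (leq_trans _ r_le)) //.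
apply: (@leq_trans (#|Y| * r.+1)); last by rewrite leq_mul2l r_le orbT.
apply: (@double_counting _ _ _ _ (fun P Q => pair_le P Q)) => [P PX|Q].
  have sP := XD _ PX; rewrite inE in sP; rewrite -(Xr _ PX) -card_upper_covers //.
  apply: subset_leq_card; apply/subsetP => Q.
  rewrite !inE => /andP[-> /andP[PQ /eqP->]]; rewrite PQ (Xr _ PX) eqxx andbT /=.
  by apply/existsP; exists P; rewrite PX.
rewrite inE => /and3P[sQ /eqP rQ _]; rewrite inE in sQ.
rewrite -rQ; apply: leq_trans (card_lower_covers_le sQ).
apply: subset_leq_card; apply/subsetP => P; rewrite !inE => /andP[PX ->].
by have := XD _ PX; rewrite inE => ->; rewrite rQ (Xr _ PX) eqxx.
Qed.

(** Each pair of rank r + 1 has at least r lower covers, and a pair of rank r has 2(|T| - r) <= r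
    upper covers. *)
Lemma card_lower_shadow r (X : {set {set T} * {set T}}) :
  2 * #|T| <= 3 * r -> X \subset opposed_pairs ->
  (forall P, P \in X -> pair_rank P = r.+1) ->
  #|X| <= #|[set Q in opposed_pairs |
              (pair_rank Q == r) && [exists P in X, pair_le Q P]]|.
Proof.
move=> hr /subsetP XD Xr; set Y := (Y in _ <= #|Y|).
have [->|/set0Pn[P0 P0X]] := eqVneq X set0; first by rewrite cards0.
(* A member of [X] gives r + 1 <= |T|, which with 2|T| <= 3r forces r >= 2. This excludes pairs of
   singletons, which have no lower cover. *)
have r_gt1 : 1 < r.
  have := XD _ P0X; rewrite inE => sP0.
  have := opposed_rank sP0; have := opposed_rank_gt1 sP0.
  by rewrite (Xr _ P0X); move: hr; clear; lia.
have r_le : 2 * (#|T| - r) <= r by move: hr; clear; lia.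
rewrite -(leq_pmul2r (ltnW r_gt1)).
apply: (@leq_trans (#|Y| * (2 * (#|T| - r)))); last by rewrite leq_mul2l r_le orbT.
apply: (@double_counting _ _ _ _ (fun P Q => pair_le Q P)) => [P PX|Q].
  have sP := XD _ PX; rewrite inE in sP.
  apply: (@leq_trans #|lower_covers P|).
    by have := card_lower_covers_ge sP; rewrite (Xr _ PX); apply; rewrite ltnS.
  apply: subset_leq_card; apply/subsetP => Q.
  rewrite !inE (Xr _ PX) eqSS => /andP[-> /andP[QP rQ]].
  rewrite QP eq_sym rQ andbT /=.
  by apply/existsP; exists P; rewrite PX.
rewrite inE => /and3P[sQ /eqP rQ _]; rewrite inE in sQ.
rewrite -rQ -card_upper_covers //.
apply: subset_leq_card; apply/subsetP => P; rewrite !inE => /andP[PX ->].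
by have := XD _ PX; rewrite inE => ->; rewrite rQ (Xr _ PX) eqxx.
Qed.

(* The level sizes increase up to the rank |T| - |T|/3 and decrease afterwards,
   so every antichain can be pushed into that level. *)
Lemma antichain_opposed_bound (X : {set {set T} * {set T}}) :
  X \subset opposed_pairs -> antichain pair_le X ->
  #|X| <= 'C(#|T|, #|T| - #|T| %/ 3) * (2 ^ (#|T| - #|T| %/ 3) - 2).
Proof.
set m := #|T| - #|T| %/ 3 => XD Xanti.
have rankT P : P \in opposed_pairs -> pair_rank P <= #|T|.
  by rewrite inE => /opposed_rank.
have divT := leq_divM #|T| 3; have ltdiv := ltn_ceil #|T| (isT : 0 < 3).
(* The first push runs in the reversed order with the corank |T| - rank, so it brings every pair to
   rank at least [m]. *)
have [||||Y [YD Yanti XY Yrk]] := @antichain_push_down _ (fun P Q => pair_le Q P)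
  (fun P => #|T| - pair_rank P) opposed_pairs (#|T| - m) _ _ _ X XD.
- by move=> P Q S PQ QS; apply: pair_le_trans QS PQ.
- move=> P Q /rankT hP /rankT hQ QP h; apply/esym/(pair_le_rank QP).
  by move: hP hQ h; clear; lia.
- move=> k Z mk ZD Zk.
  have [->|/set0Pn[P0 P0Z]] := eqVneq Z set0; first by rewrite cards0.
  have kT : k < #|T| by rewrite -(Zk _ P0Z) leq_subr.
  apply: leq_trans (@card_upper_shadow (#|T| - k.+1) Z _ ZD _) _.
  + by move: mk divT ltdiv kT; rewrite /m; clear; lia.
  + move=> P PZ; have := rankT _ (subsetP ZD _ PZ); have := Zk _ PZ.
    by clear; lia.
  apply: subset_leq_card; apply/subsetP => Q.
  rewrite !inE => /and3P[-> /eqP-> ->]; rewrite andbT /=.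
  by rewrite subnSK // subKn // ltnW.
- by move=> P Q PX QX QP; apply/esym/Xanti.
have [||||Z [ZD Zanti YZ Zrk]] := @antichain_push_down _ pair_le
  pair_rank opposed_pairs m _ _ _ Y YD.
- exact: pair_le_trans.
- by move=> P Q _ _; apply: pair_le_rank.
- move=> k W mk WD Wk; apply: card_lower_shadow => //.
  by move: mk divT ltdiv; rewrite /m; clear; lia.
- by move=> P Q PX QX QP; apply/esym/Yanti.
apply: leq_trans XY (leq_trans YZ (leq_trans _ (card_opposed_level m))).
apply: subset_leq_card; apply/subsetP => P PZ; rewrite inE (subsetP ZD) //=.
(* The second push keeps ranks at least [m]: its new pairs satisfy this, and so do those kept from
   [Y]. *)
have [Pm PYm] := Zrk _ PZ; rewrite eqn_leq Pm /=.
case: PYm => // PY; have [+ _] := Yrk _ PY.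
have := rankT _ (subsetP YD _ PY).
by rewrite /m; move: divT; clear; lia.
Qed.

End OpposedPairs.

(** * Recurrent pairs *)

Section Trajectories.
Variables (T : finType) (I : Type) (F : I -> {set T} -> {set T}).
Hypothesis F_setI : forall i A B, F i (A :&: B) = F i A :&: F i B.
Hypothesis F_set0 : forall i, F i set0 = set0.
Implicit Types (sigma : nat -> I) (P Q : {set T} * {set T}).

(* The unordered pairs of the argument are encoded as ordered ones, compared up
   to [swap]; counting both orders accounts for the factor 2 in the bounds. *)
Definition pair_ule P Q : bool := pair_le P Q || pair_le (swap P) Q.

Lemma pair_ule_trans : transitive pair_ule.
Proof.
move=> Q P S; rewrite /pair_ule => /orP[] PQ /orP[] QS; apply/orP.
- by left; apply: pair_le_trans PQ QS.
- right; apply: pair_le_trans QS; rewrite /pair_le /swap /= andbC; exact: PQ.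
- by right; apply: pair_le_trans PQ QS.
- left; apply: pair_le_trans QS; move: PQ; by rewrite /pair_le /swap /= andbC.
Qed.

Fixpoint set_orbit sigma (S : {set T}) (t : nat) : {set T} :=
  if t is t'.+1 then F (sigma t') (set_orbit sigma S t') else S.

Definition pair_orbit sigma P t : {set T} * {set T} :=
  (set_orbit sigma P.1 t, set_orbit sigma P.2 t).

Lemma pair_orbit0 sigma P : pair_orbit sigma P 0 = P.
Proof. by case: P. Qed.

Lemma F_subset i (A B : {set T}) : A \subset B -> F i A \subset F i B.
Proof. by move=> /setIidPl <-; rewrite F_setI subsetIr. Qed.

Lemma set_orbitS sigma (A B : {set T}) t :
  A \subset B -> set_orbit sigma A t \subset set_orbit sigma B t.
Proof. by move=> AB; elim: t => //= t IHt; apply: F_subset. Qed.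

Lemma set_orbitI sigma (A B : {set T}) t :
  set_orbit sigma (A :&: B) t = set_orbit sigma A t :&: set_orbit sigma B t.
Proof. by elim: t => //= t ->; rewrite F_setI. Qed.

Lemma set_orbit0 sigma t : set_orbit sigma set0 t = set0.
Proof. by elim: t => //= t ->; rewrite F_set0. Qed.

Lemma pair_orbitD sigma P s t :
  pair_orbit (fun u => sigma (u + s)) (pair_orbit sigma P s) t =
  pair_orbit sigma P (t + s).
Proof.
by rewrite /pair_orbit /=; congr pair; elim: t => //= t ->.
Qed.

Lemma eq_pair_orbit sigma tau P t :
  (forall u, u < t -> sigma u = tau u) -> pair_orbit sigma P t = pair_orbit tau P t.
Proof.
move=> e; rewrite /pair_orbit; congr pair.
  by elim: t e => //= t IHt e; rewrite IHt ?e // => u ut; apply: e; apply: ltnW.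
by elim: t e => //= t IHt e; rewrite IHt ?e // => u ut; apply: e; apply: ltnW.
Qed.

Lemma pair_orbit_ule sigma P Q t :
  pair_ule P Q -> pair_ule (pair_orbit sigma P t) (pair_orbit sigma Q t).
Proof. by case/orP => /andP[h1 h2]; apply/orP; [left|right]; rewrite /pair_le !set_orbitS. Qed.

(** An empty component stays empty and disjoint sets stay disjoint, so survival at time [t] implies
    survival before. *)
Lemma opposed_orbit_le sigma P s t : s <= t -> [disjoint P.1 & P.2] ->
  opposed (pair_orbit sigma P t) -> opposed (pair_orbit sigma P s).
Proof.
move=> /subnK <- dP; rewrite -pair_orbitD => /and3P[/= h1 h2 _].
apply/and3P; split => /=.
- by apply: contraNneq h1 => ->; rewrite set_orbit0.
- by apply: contraNneq h2 => ->; rewrite set_orbit0.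
- by rewrite -setI_eq0 -set_orbitI (disjoint_setI0 dP) set_orbit0.
Qed.

Lemma opposed_ule P Q :
  opposed P -> [disjoint Q.1 & Q.2] -> pair_ule P Q -> opposed Q.
Proof.
move=> /and3P[a0 b0 _] dQ h; apply/and3P; rewrite dQ.
have sub_neq0 (A B : {set T}) : A \subset B -> A != set0 -> B != set0.
  by move=> AB; apply: contraNneq => B0; rewrite -subset0 -B0.
case/orP: h => /andP[/= h1 h2]; split=> //; by [apply: sub_neq0 h1 _ | apply: sub_neq0 h2 _].
Qed.

Lemma opposed_recurrent_le sigma P s t : s <= t -> opposed P ->
  pair_ule P (pair_orbit sigma P t) -> opposed (pair_orbit sigma P s).
Proof.
move=> st sP Pt; have /and3P[_ _ dP] := sP.
have dt : [disjoint (pair_orbit sigma P t).1 & (pair_orbit sigma P t).2].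
  by rewrite /= -setI_eq0 -set_orbitI (disjoint_setI0 dP) set_orbit0.
exact: opposed_orbit_le st dP (opposed_ule sP dt Pt).
Qed.

Lemma pair_ule_period sigma P p k : (forall t, sigma (t + p) = sigma t) ->
  pair_ule P (pair_orbit sigma P p) -> pair_ule P (pair_orbit sigma P (k * p)).
Proof.
move=> per Pp; elim: k => [|k IHk]; first by rewrite mul0n pair_orbit0 /pair_ule pair_le_refl.
apply: pair_ule_trans IHk _; rewrite mulSnr -pair_orbitD.
rewrite (@eq_pair_orbit _ sigma); last by move=> u _; apply: per.
exact: pair_orbit_ule.
Qed.

Definition recurrence_bound : nat :=
  'C(#|T|, #|T| - #|T| %/ 3) * (2 ^ (#|T| - #|T| %/ 3) - 2).

(* A recurrence of minimal length runs through pairwise incomparable pairs: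
   a comparison P_i <= P_j with i < j gives the recurrence from i to j, and one
   with j < i the recurrence that goes from i through the end back to j. *)
Lemma short_recurrence sigma P p :
  0 < p -> opposed P -> pair_ule P (pair_orbit sigma P p) ->
  exists tau Q q, [/\ 0 < q, 2 * q <= recurrence_bound, opposed Q,
    forall t, tau (t + q) = tau t & pair_ule Q (pair_orbit tau Q q)].
Proof.
elim/ltn_ind: p sigma P => p IHp sigma P p0 sP.
(* Repeating the first [p] indices makes the sequence periodic, so the orbit can be followed past
   time [p]. *)
pose tau t := sigma (t %% p).
rewrite (@eq_pair_orbit _ tau); last by move=> u up; rewrite /tau modn_small.
move=> Pp; have per t : tau (t + p) = tau t by rewrite /tau modnDr.
pose Q t := pair_orbit tau P t.
have sQ t : t <= p -> opposed (Q t).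
  by move=> tp; apply: opposed_recurrent_le tp sP Pp.
have [/existsP[i /existsP[j /andP[ij Qij]]]|noij] :=
  boolP [exists i : 'I_p, exists j : 'I_p, (i != j) && pair_ule (Q i) (Q j)].
  have := ltn_ord i; have := ltn_ord j => jp ip.
  case: (ltngtP i j) => [lt_ij|lt_ji|/ord_inj eij]; last by rewrite eij eqxx in ij.
    apply: (IHp (j - i) _ (fun u => tau (u + i)) (Q i)); rewrite ?subn_gt0 //.
    - by apply: leq_ltn_trans (leq_subr _ _) jp.
    - exact: sQ (ltnW ip).
    - by rewrite /Q pair_orbitD subnK // ltnW.
  (* The detour from time [i] to time [j + p] is shorter than [p] because [j < i]. It is a
     recurrence since [Q i] is below [Q j], and [j] steps applied to the return at time [p] put
     [Q j] below [Q (j + p)]. *)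
  have eji : p - i + j + i = j + p by move: ip lt_ji; clear; lia.
  apply: (IHp (p - i + j) _ (fun u => tau (u + i)) (Q i)).
  - by move: ip lt_ji; clear; lia.
  - by move: ip; clear; lia.
  - exact: sQ (ltnW ip).
  apply: pair_ule_trans Qij _; rewrite pair_orbitD eji -pair_orbitD.
  rewrite [X in pair_ule _ X](@eq_pair_orbit _ tau); last by move=> u _; apply: per.
  exact: pair_orbit_ule.
have uleQ (i j : 'I_p) : pair_ule (Q i) (Q j) -> i = j.
  move=> Qij; apply: contraNeq noij => ij.
  by apply/existsP; exists i; apply/existsP; exists j; rewrite ij.
exists tau, P, p; split=> //.
(* Both orders of the [p] pairs form an antichain of size 2p: a pair is not comparable to its own
   swap, its sides being disjoint and nonempty. *)
pose f (x : 'I_p * bool) := if x.2 then Q x.1 else swap (Q x.1).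
have f_le x y : pair_le (f x) (f y) -> x = y.
  have ulef : pair_le (f x) (f y) -> pair_ule (Q x.1) (Q y.1).
    rewrite /f /pair_ule /pair_le /swap; case: x.2; case: y.2 => /= /andP[-> ->];
    by rewrite ?orbT.
  case: x y ulef => [i b] [j c] ulef h; have eij := uleQ _ _ (ulef h).
  rewrite /= in eij; rewrite {}eij in h *; congr pair.
  have /and3P[/set0Pn[u ua] _ dQ] := sQ j (ltnW (ltn_ord j)).
  move: h {ulef}; rewrite /f /pair_le /swap; case: b; case: c => //= /andP[/subsetP h1 /subsetP h2].
    by have := h1 u ua; rewrite (disjointFr dQ ua).
  by have := h2 u ua; rewrite (disjointFr dQ ua).
have f_inj : injective f by move=> x y e; apply: f_le; rewrite e pair_le_refl.
have -> : 2 * p = #|f @: setT|.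
  by rewrite card_imset // cardsT card_prod card_bool card_ord mulnC.
apply: antichain_opposed_bound.
  apply/subsetP => _ /imsetP[[i b] _ ->]; rewrite inE /f /=.
  have si := sQ i (ltnW (ltn_ord i)); case: b => //.
  by move: si; rewrite /opposed /swap /= disjoint_sym => /and3P[-> -> ->].
by move=> _ _ /imsetP[x _ ->] /imsetP[y _ ->] /f_le ->.
Qed.

(** Of the pairs at times 0 to N, where N counts all pairs of sets, two coincide; the exact return
    between them is then shortened. *)
Lemma survivor_recurrence sigma P :
  opposed P -> opposed (pair_orbit sigma P #|{: {set T} * {set T}}|) ->
  exists tau Q q, [/\ 0 < q, 2 * q <= recurrence_bound, opposed Q,
    forall t, tau (t + q) = tau t & pair_ule Q (pair_orbit tau Q q)].
Proof.
set N := #|_| => sP sN; have /and3P[_ _ dP] := sP.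
pose f (i : 'I_N.+1) := pair_orbit sigma P i.
have /injectivePn[i [j ij fij]] : ~~ injectiveb f.
  by apply/injectiveP => /leq_card; rewrite card_ord ltnn.
wlog lt_ij : i j ij fij / i < j.
  move=> h; case: (ltngtP i j) => [|ji|/ord_inj eij]; first exact: h.
    by apply: (h j i) => //; rewrite eq_sym.
  by rewrite eij eqxx in ij.
apply: (@short_recurrence (fun u => sigma (u + i)) (f i) (j - i)).
- by rewrite subn_gt0.
- by apply: opposed_orbit_le dP sN; rewrite -ltnS.
- by rewrite pair_orbitD subnK ?(ltnW lt_ij) // -/(f j) -fij /pair_ule pair_le_refl.
Qed.

End Trajectories.

(** * Products of stochastic matrices *)

From mathcomp Require Import all_order all_algebra.
From mathcomp Require Import all_classical all_reals all_analysis.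
From mathcomp Require Import lra.
Import Order.TTheory GRing.Theory Num.Theory numFieldNormedType.Exports.
Local Open Scope ring_scope.

Section Stochastic.
Variables (R : realType) (n : nat).
Implicit Types (B C : 'M[R]_n) (S : {set 'I_n}).

Lemma stochastic1 : stochastic (1%:M : 'M[R]_n).
Proof.
split=> [i j|i]; first by rewrite mxE ler0n.
rewrite (bigD1 i) //= big1 => [|j ji]; first by rewrite mxE eqxx addr0.
by rewrite mxE eq_sym (negbTE ji).
Qed.

Lemma stochasticM B C : stochastic B -> stochastic C -> stochastic (B *m C).
Proof.
move=> [B0 B1] [C0 C1]; split=> [i j|i].
  by rewrite mxE sumr_ge0 // => k _; rewrite mulr_ge0.
under eq_bigr do rewrite mxE.
rewrite exchange_big /= -[RHS](B1 i); apply: eq_bigr => k _.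
by rewrite -mulr_sumr C1 mulr1.
Qed.

Lemma stochastic_le1 B i j : stochastic B -> B i j <= 1.
Proof.
move=> [B0 B1]; rewrite -(B1 i) (bigD1 j) //= lerDl sumr_ge0 //.
Qed.

Lemma stochastic_avg_le B (x : 'I_n -> R) c i :
  stochastic B -> (forall k, x k <= c) -> \sum_k B i k * x k <= c.
Proof.
move=> [B0 B1] xc; rewrite -[leRHS]mul1r -(B1 i) mulr_suml.
by apply: ler_sum => k _; rewrite ler_wpM2l.
Qed.

Lemma stochastic_avg_ge B (x : 'I_n -> R) c i :
  stochastic B -> (forall k, c <= x k) -> c <= \sum_k B i k * x k.
Proof.
move=> [B0 B1] xc; rewrite -[leLHS]mul1r -(B1 i) mulr_suml.
by apply: ler_sum => k _; rewrite ler_wpM2l.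
Qed.

Lemma stochastic_avg_le_at B (x : 'I_n -> R) c e i k :
  stochastic B -> (forall l, x l <= c) -> e <= B i k ->
  \sum_l B i l * x l <= c - e * (c - x k).
Proof.
move=> [B0 B1] xc eB; rewrite -[c in c - _]mul1r -(B1 i) mulr_suml.
rewrite (bigD1 k) //= [in leRHS](bigD1 k) //= [leRHS]addrAC.
apply: lerD; last by apply: ler_sum => l _; rewrite ler_wpM2l.
by rewrite lerBrDr -lerBrDl -mulrBr ler_wpM2r // subr_ge0.
Qed.

(* Both averages are pulled towards the value of x at a common neighbour. *)
Lemma overlapping_contraction B (x : 'I_n -> R) (e d : R) :
  stochastic B -> e <= 1 -> (forall k l, x k - x l <= d) ->
  (forall i j, exists2 k, e <= B i k & e <= B j k) ->
  forall i j, \sum_k B i k * x k - \sum_k B j k * x k <= (1 - e) * d.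
Proof.
move=> sB e1 xd ov i j.
have [a xa] : exists a, forall k, x k <= x a.
  by case: (arg_maxP x (erefl (xpredT i))) => a _ xa; exists a => k; apply: xa.
have [b xb] : exists b, forall k, x b <= x k.
  by case: (arg_minP x (erefl (xpredT i))) => b _ xb; exists b => k; apply: xb.
have [k Bik Bjk] := ov i j.
have hi := stochastic_avg_le_at sB xa Bik.
have hj : \sum_l B j l * - x l <= - x b - e * (- x b + x k).
  have := @stochastic_avg_le_at B (fun l => - x l) (- x b) e j k sB _ Bjk.
  by rewrite opprK; apply=> l; rewrite lerN2.
(* Adding [hi] and [hj] cancels [x k] and leaves (1 - e)(x a - x b), which this inequality compares
   with (1 - e) d. *)
have e_x : 0 <= (1 - e) * (d - (x a - x b)) by rewrite mulr_ge0 // subr_ge0.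
move: hj; under eq_bigr do rewrite mulrN; rewrite sumrN => hj.
nra.
Qed.

(** This is F_B(S): for stochastic [B], the states of the Markov chain that move into [S] with
    probability one. *)
Definition rows_within B S : {set 'I_n} :=
  [set i | [forall j, (j \in S) || (B i j == 0)]].

Lemma rows_withinP B S i :
  reflect (forall j, j \notin S -> B i j = 0) (i \in rows_within B S).
Proof.
rewrite inE; apply: (iffP forallP) => h j.
  by move=> jS; have := h j; rewrite (negbTE jS) => /eqP.
by case: (boolP (j \in S)) => //= jS; rewrite h.
Qed.

Lemma rows_withinI B S S' :
  rows_within B (S :&: S') = rows_within B S :&: rows_within B S'.
Proof.
apply/setP => i; rewrite [RHS]inE; apply/rows_withinP/andP => [h|[/rows_withinP h /rows_withinP h'] j].
  by split; apply/rows_withinP => j jS; apply: h; rewrite inE (negbTE jS) ?andbF.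
by rewrite inE negb_and => /orP[/h|/h'].
Qed.

Lemma rows_within0 B : stochastic B -> rows_within B finset.set0 = finset.set0.
Proof.
move=> [_ B1]; apply/setP => i; rewrite [RHS]inE; apply/rows_withinP => h.
have /eqP := B1 i; rewrite big1 ?(eq_sym 0) ?oner_eq0 // => j _.
by rewrite h // inE.
Qed.

Lemma rows_within1 S : rows_within 1%:M S = S.
Proof.
apply/setP => i; apply/rows_withinP/idP => [h|iS j jS].
  by apply: contraT => /h /eqP; rewrite mxE eqxx oner_eq0.
by rewrite mxE; case: eqP => // eij; rewrite -eij iS in jS.
Qed.

(** Nonnegative terms cannot cancel, so an entry of the product vanishes exactly when each of its
    terms does. *)
Lemma rows_withinM B C S : (forall i j, 0 <= B i j) -> (forall i j, 0 <= C i j) ->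
  rows_within (B *m C) S = rows_within B (rows_within C S).
Proof.
move=> B0 C0; apply/setP => i; apply/rows_withinP/rows_withinP => [h k|h j jS].
  rewrite inE negb_forall => /existsP[j]; rewrite negb_or => /andP[jS Ckj].
  have /eqP := h j jS; rewrite mxE psumr_eq0 => [|l _]; last exact: mulr_ge0.
  by move=> /allP/(_ k (mem_index_enum _)); rewrite mulf_eq0 (negbTE Ckj) orbF => /eqP.
rewrite mxE big1 // => k _; have [kC|/h->] := boolP (k \in rows_within C S); last by rewrite mul0r.
by rewrite (rows_withinP _ _ _ kC) ?mulr0.
Qed.

Lemma rows_within_sum1 B S i : stochastic B -> i \in rows_within B S ->
  \sum_(j in S) B i j = 1.
Proof.
move=> [_ B1] /rows_withinP h; rewrite -(B1 i) [RHS](bigID [in S]) /=.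
by rewrite [X in _ + X]big1 ?addr0 // => j /h.
Qed.

Lemma rows_within_sum0 B S S' i : [disjoint S & S'] ->
  i \in rows_within B S' -> \sum_(j in S) B i j = 0.
Proof.
move=> dS /rows_withinP h; apply: big1 => j jS; apply: h.
by rewrite (disjointFr dS jS).
Qed.

End Stochastic.

Section Products.
Variables (R : realType) (n m : nat) (A : 'I_m -> 'M[R]_n).
Hypothesis A_stochastic : forall k, stochastic (A k).
Implicit Types (sigma : nat -> 'I_m).

Lemma stochastic_prodL sigma t : stochastic (prodL A sigma t).
Proof. by elim: t => [|t IHt] /=; [exact: stochastic1 | exact: stochasticM]. Qed.

Lemma prodLD sigma s t :
  prodL A sigma (t + s) = prodL A (fun u => sigma (u + s)%N) t *m prodL A sigma s.
Proof. by elim: t => [|t IHt] /=; rewrite ?mul1mx // IHt mulmxA. Qed.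

Let F k : {set 'I_n} -> {set 'I_n} := rows_within (A k).

Lemma set_orbit_rows_within sigma S t :
  set_orbit F sigma S t = rows_within (prodL A sigma t) S.
Proof.
elim: t => [|t IHt] /=; first by rewrite rows_within1.
rewrite IHt rows_withinM //; first by have [] := A_stochastic (sigma t).
by have [] := stochastic_prodL sigma t.
Qed.

(** The supports of two rows, if disjoint, would form an opposed pair surviving [N] steps, as each
    row lies within its own support. *)
Lemma no_survivor_overlap N sigma i i' :
  (forall P, opposed P -> ~~ opposed (pair_orbit F sigma P N)) ->
  exists k, (prodL A sigma N i k != 0) && (prodL A sigma N i' k != 0).
Proof.
move=> noS; apply/existsP; apply: contraT; rewrite negb_exists => /forallP disj.
pose supp l := [set k | prodL A sigma N l k != 0]%SET.
have dP : [disjoint supp i & supp i'].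
  by apply/pred0P => k /=; rewrite !inE; apply/negbTE/disj.
have mem_rows l : l \in rows_within (prodL A sigma N) (supp l).
  by apply/rows_withinP => k; rewrite inE negbK => /eqP.
have supp_neq0 l : supp l != finset.set0.
  have sP := stochastic_prodL sigma N; apply/negP => /eqP s0.
  by have := mem_rows l; rewrite s0 rows_within0 // inE.
have sP : opposed (supp i, supp i') by rewrite /opposed !supp_neq0.
case/negP: (noS _ sP); apply/and3P; rewrite /= !set_orbit_rows_within.
split; first by apply/set0Pn; exists i.
  by apply/set0Pn; exists i'.
rewrite -finset.setI_eq0 -rows_withinI (disjoint_setI0 dP) rows_within0 //.
exact: stochastic_prodL.
Qed.

Local Open Scope classical_set_scope.

Lemma limit_row_sum sigma M i :
  lprod_converges_to A sigma M -> \sum_j M i j = 1.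
Proof.
move=> AM.
have h : (fun t => \sum_j prodL A sigma t i j) @ \oo --> \sum_j M i j.
  by apply: cvg_big => [|j _]; [exact: add_continuous | exact: AM].
apply: (cvg_unique (@Rhausdorff R) h).
rewrite (_ : (fun t => _) = fun=> 1); first exact: cvg_cst.
by apply/funext => t; have [_ ->] := stochastic_prodL sigma t.
Qed.

(** In a factorization [c *m r] through dimension one, each entry of [c] times the sum of [r] is 1,
    so [c] is constant. *)
Lemma rank1_equal_rows (M : 'M[R]_n) i i' j :
  \rank M = 1%N -> (forall i, \sum_j M i j = 1) -> M i j = M i' j.
Proof.
move=> rM; have : exists (c : 'M[R]_(n, \rank M)) (r : 'M[R]_(\rank M, n)), M = c *m r.
  by exists (col_base M), (row_base M); rewrite mulmx_base.
rewrite rM => -[c [r ->]] sum1.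
have cr k l : (c *m r) k l = c k ord0 * r ord0 l by rewrite mxE big_ord1.
have c1 k : c k ord0 * \sum_l r ord0 l = 1.
  by rewrite -[RHS](sum1 k) mulr_sumr; apply: eq_bigr => l _; rewrite cr.
rewrite !cr; congr (_ * _); have := c1 i; rewrite -(c1 i') => /mulIf; apply.
apply: contra_eq_neq (c1 i) => ->; by rewrite mulr0 eq_sym oner_eq0.
Qed.

Lemma equal_rows_rank1 (M : 'M[R]_n) (i0 : 'I_n) :
  (forall i i' j, M i j = M i' j) -> \sum_j M i0 j = 1 -> \rank M = 1%N.
Proof.
move=> eqM sum1; have ME : M = const_mx 1 *m row i0 M :> 'M[R]_n.
  by apply/matrixP => i j; rewrite !mxE big_ord1 !mxE mul1r; apply: eqM.
apply/eqP; rewrite eqn_leq {1}ME mulmx_max_rank lt0n mxrank_eq0 /=.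
apply: contra_eq_neq sum1 => ->; rewrite big1 ?(eq_sym 0) ?oner_eq0 // => j _.
by rewrite mxE.
Qed.

(** The mass on [P.1] of a row from [P.1] minus that of a row from [P.2] is 1 or -1 at every
    multiple of [p], the sign depending on a swap. With a rank one limit it would tend to 0. *)
Lemma recurrence_not_rank1 sigma P p :
  (forall t, sigma (t + p)%N = sigma t) -> (0 < p)%N -> opposed P ->
  pair_ule P (pair_orbit F sigma P p) -> ~ lprod_converges_rank1 A sigma.
Proof.
move=> per p0 sP Pp [M [AM rM]].
have FI k S S' : F k (S :&: S') = F k S :&: F k S' by apply: rows_withinI.
have Pk k := pair_ule_period FI k per Pp.
have /and3P[/set0Pn[s sP1] /set0Pn[s' sP2] dP] := sP.
pose g t := \sum_(j in P.1) (prodL A sigma t s j - prodL A sigma t s' j).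
have g0 : g @ \oo --> (0 : R).
  rewrite (_ : 0 = \sum_(j in P.1) (M s j - M s' j)).
    apply: cvg_big => [|j _]; first exact: add_continuous.
    by apply: cvgB; apply: AM.
  rewrite big1 // => j _; rewrite (@rank1_equal_rows M s s') ?subrr //.
  by move=> i; apply: limit_row_sum AM.
have gE t : g t = \sum_(j in P.1) prodL A sigma t s j - \sum_(j in P.1) prodL A sigma t s' j.
  by rewrite /g sumrB.
have g1 k : `|g (k * p)%N| = 1.
  have st := stochastic_prodL sigma (k * p); rewrite gE.
  have := Pk k; rewrite /pair_ule /pair_le /swap /=.
  rewrite !set_orbit_rows_within => /orP[] /andP[/fintype.subsetP h1 /fintype.subsetP h2].
    by rewrite (rows_within_sum1 st (h1 _ sP1)) (rows_within_sum0 dP (h2 _ sP2)) subr0 normr1.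
  by rewrite (rows_within_sum0 dP (h2 _ sP1)) (rows_within_sum1 st (h1 _ sP2)) sub0r normrN normr1.
move/cvgrPdist_lt: g0 => /(_ 1 ltr01) [N _ /(_ (N * p)%N)] /=.
by rewrite sub0r normrN g1 ltxx leq_pmulr // => /(_ isT).
Qed.

Lemma entries_bounded_below :
  exists2 a : R, 0 < a <= 1 & forall k i j, A k i j != 0 -> a <= A k i j.
Proof.
pose f (x : 'I_m * 'I_n * 'I_n) := A x.1.1 x.1.2 x.2.
(* The default 1 covers an empty family and ensures that the bound is at most 1. *)
exists (\big[Order.min/1]_(x | f x != 0) f x).
  rewrite bigmin_le_id andbT; apply: lt_bigmin => // x fx.
  by rewrite lt_def fx; have [-> _] := A_stochastic x.1.1.
by move=> k i j Akij; apply: (@bigmin_le_cond _ _ _ 1 (k, i, j) (fun x => f x != 0) f).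
Qed.

(** A nonzero entry has a nonzero term, whose factors are bounded by [a] and by induction; the other
    terms are nonnegative. *)
Lemma prodL_bounded_below (a : R) sigma t i j :
  0 <= a -> (forall k i j, A k i j != 0 -> a <= A k i j) ->
  prodL A sigma t i j != 0 -> a ^+ t <= prodL A sigma t i j.
Proof.
move=> a0 Aa; elim: t i j => [|t IHt] i j /=.
  by rewrite mxE; case: (i == j); rewrite ?eqxx // expr0.
have [At0 _] := A_stochastic (sigma t); have [P0 _] := stochastic_prodL sigma t.
rewrite mxE => nz.
have [k nzk] : exists k, A (sigma t) i k * prodL A sigma t k j != 0.
  apply/existsP; apply: contraNT nz; rewrite negb_exists => /forallP h.
  by apply/eqP/big1 => k _; apply/eqP; have := h k; rewrite negbK.
move: (nzk); rewrite mulf_eq0 negb_or => /andP[nzA nzP].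
rewrite (bigD1 k) //= exprS -[leLHS]addr0; apply: lerD.
  by apply: ler_pM; rewrite ?exprn_ge0 ?Aa ?IHt.
by apply: sumr_ge0 => l _; rewrite mulr_ge0.
Qed.

(** * Geometric contraction of the gaps between rows *)

Section Contraction.
Variables (N : nat) (e : R).
Hypotheses (e_gt0 : 0 < e) (e_le1 : e <= 1).
Hypothesis overlap : forall sigma i i',
  exists2 k, e <= prodL A sigma N i k & e <= prodL A sigma N i' k.

(** Entries in [0, 1] start the induction; each further block of [N] factors on the left contracts
    the gaps by 1 - e. *)
Lemma prodL_row_gap sigma k i i' j :
  prodL A sigma (k * N) i j - prodL A sigma (k * N) i' j <= (1 - e) ^+ k.
Proof.
elim: k i i' => [|k IHk] i i'.
  have [P0 _] := stochastic_prodL sigma (0 * N).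
  rewrite expr0; apply: le_trans (stochastic_le1 i j (stochastic_prodL sigma (0 * N))).
  by rewrite lerBlDr lerDl.
rewrite mulSn prodLD !mxE exprS.
exact: (overlapping_contraction (stochastic_prodL _ _)).
Qed.

(** Rows from time [k * N] on are convex combinations of the rows at that time. Distinct times give
    the Cauchy property, distinct rows the equality of the limit rows. *)
Lemma prodL_gap sigma k t t' i i' j : (k * N <= t)%N -> (k * N <= t')%N ->
  `|prodL A sigma t i j - prodL A sigma t' i' j| <= (1 - e) ^+ k.
Proof.
wlog suff gap : t t' i i' / (k * N <= t)%N -> (k * N <= t')%N ->
    prodL A sigma t i j - prodL A sigma t' i' j <= (1 - e) ^+ k.
  by move=> kt kt'; rewrite ler_norml lerNl opprB !gap.
move=> /subnK <- /subnK <-; rewrite lerBlDr -lerBlDl !prodLD !mxE.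
apply: (@stochastic_avg_ge _ _ _ (fun l => prodL A sigma (k * N) l j) _ _
  (stochastic_prodL _ _)) => l.
rewrite lerBlDl.
apply: (@stochastic_avg_le _ _ _ (fun l => prodL A sigma (k * N) l j) _ _
  (stochastic_prodL _ _)) => l'.
by rewrite -lerBlDr prodL_row_gap.
Qed.

Lemma overlap_converges_rank1 sigma (i0 : 'I_n) : lprod_converges_rank1 A sigma.
Proof.
have geo eps : 0 < eps -> exists k, (1 - e) ^+ k < eps.
  move=> eps0; have e1 : `|1 - e| < 1.
    by rewrite ger0_norm ?subr_ge0 // ltrBlDr ltrDl.
  have /cvgrPdist_lt/(_ _ eps0) [k _ /(_ k (leqnn k))] := cvg_expr e1.
  rewrite /= sub0r normrN ger0_norm ?exprn_ge0 ?subr_ge0 // => h.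
  by exists k.
have cvgP i j : cvg ((fun t => prodL A sigma t i j) @ \oo).
  apply/cauchy_cvgP/cauchy_exP => eps eps0; have [k keps] := geo _ eps0.
  exists (prodL A sigma (k * N) i j); exists (k * N)%N => // t /= kt.
  by rewrite /ball /=; apply: le_lt_trans keps; apply: prodL_gap.
pose M := \matrix_(i, j) lim ((fun t => prodL A sigma t i j) @ \oo).
have AM : lprod_converges_to A sigma M by move=> i j; rewrite mxE; apply: cvgP.
exists M; split=> //; apply: (@equal_rows_rank1 _ i0); last exact: limit_row_sum AM.
move=> i i' j; apply/eqP; rewrite -subr_eq0 -normr_le0; apply/ler_addgt0Pl => eps eps0.
have [k keps] := geo _ eps0; rewrite addr0.
have h : `|(fun t => prodL A sigma t i j - prodL A sigma t i' j) t| @[t --> \oo] --> `|M i j - M i' j|.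
  by apply: cvg_norm; apply: cvgB; apply: AM.
rewrite -(cvg_lim _ h) //; apply: limr_le; first by apply/cvg_ex; eexists; exact: h.
exists (k * N)%N => // t /= kt.
exact: le_trans (prodL_gap _ _ _ _ kt kt) (ltW keps).
Qed.

End Contraction.

End Products.

(** Symmetry of the binomial and 2^k - 2 = 2(2^(k-1) - 1) for k = n - n/3, which is positive when n
    > 0; both sides are 0 for n = 0. *)
Lemma recurrence_bound_pstar n : recurrence_bound 'I_n = (2 * pstar n)%N.
Proof.
rewrite /recurrence_bound /pstar card_ord bin_sub ?leq_div //.
case: n => [|n]; first by [].
rewrite -[(_.+1 - _ %/ 3)%N]prednK; last by rewrite subn_gt0 ltn_Pdiv.
by rewrite mulnCA; congr (_ * _)%N; rewrite mulnBr muln1 -expnS subn1.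
Qed.

Theorem theorem4 (R : realType) (n : nat) (hn : (1 <= n)%N)
    (m : nat) (A : 'I_m -> 'M[R]_n)
    (hA : forall k, stochastic (A k)) :
  (forall sigma : nat -> 'I_m, lprod_converges_rank1 A sigma) <->
  (forall sigma : nat -> 'I_m,
     (exists p, periodic_with sigma p /\ (p <= pstar n)%N) ->
     lprod_converges_rank1 A sigma).
Proof.
split=> [h sigma _ //|h sigma].
pose F k := rows_within (A k).
have FI k (S S' : {set 'I_n}) : F k (S :&: S')%SET = (F k S :&: F k S')%SET.
  exact: rows_withinI.
have F0 k : F k finset.set0 = finset.set0 by apply: rows_within0.
pose N := #|{: {set 'I_n} * {set 'I_n}}|.
(* A survivor would yield a sequence of period at most [pstar n] with a recurrence, which [h]
   forbids. *)
have noS tau (P : {set 'I_n} * {set 'I_n}) :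
  opposed P -> ~~ opposed (pair_orbit F tau P N).
  move=> sP; apply/negP => sN.
  have [rho [Q [q [q0 qle sQ per Qq]]]] := survivor_recurrence FI F0 sP sN.
  apply: (recurrence_not_rank1 hA per q0 sQ Qq); apply: h.
  by exists q; split=> //; move: qle; rewrite recurrence_bound_pstar leq_pmul2l.
have [a /andP[a0 a1] Aa] := entries_bounded_below hA.
(* Nonzero entries of a product of length [N] are at least [a ^+ N]; [Ordinal hn] merely supplies a
   row index. *)
apply: (@overlap_converges_rank1 _ _ _ _ hA N (a ^+ N) _ _ _ _ (Ordinal hn)).
- exact: exprn_gt0.
- by apply: exprn_ile1 => //; apply: ltW.
move=> tau i i'; have [k /andP[ki ki']] := no_survivor_overlap hA i i' (noS tau).
by exists k; apply: prodL_bounded_below => //; apply: ltW.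
Qed.
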